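(* Let $X\subset\mathbb{R}^n$ and $Y\subset\mathbb{R}^m$ be arbitrary sets. Then the following statements are equivalent: (1) $X$ and $Y$ are outer lipeomorphic at infinity; (2) the germs of the stereographic modifications $(\widehat{X},e_{n+1})$ and $(\widehat{Y},e_{m+1})$ are outer lipeomorphic; (3) the germs of the inversions $(\iota(X\setminus\{0\}),0)$ and $(\iota(Y\setminus\{0\}),0)$ are outer lipeomorphic.
   Context: The outer distance on a subset of a Euclidean space is the restriction of the Euclidean distance. An outer lipeomorphism is a bijection that is Lipschitz with Lipschitz inverse with respect to the outer distances. $X$ and $Y$ are outer lipeomorphic at infinity if there are compact sets $K\subset\mathbb{R}^n$, $\tilde K\subset\mathbb{R}^m$ and an outer lipeomorphism $X\setminus K\to Y\setminus\tilde K$. Two germs $(A,p)$ and $(B,q)$ of subsets of Euclidean spaces (where $p$ need not lie in $A$ and $q$ need not lie in $B$) are outer lipeomorphic if there are open neighbourhoods $U$ of $p$ and $V$ of $q$ and an outer lipeomorphism $h\colon A\cap U\to B\cap V$ sending $p$ to $q$, i.e. $h(p)=q$ if $p\in A$, and $h(x)\to q$ as $x\to p$, $x\in A\cap U$. Inversion: $\iota\colon\mathbb{R}^k\setminus\{0\}\to\mathbb{R}^k\setminus\{0\}$, $\iota(x)=\frac{x}{\|x\|^2}$ (for $k=n$ or $k=m$). Stereographic modification: let $e_{n+1}=(0,\dots,0,1)\in\mathbb{R}^{n+1}$, let $\mathbb{S}^n$ be the unit sphere of $\mathbb{R}^{n+1}$, and let $\rho\colon\mathbb{S}^n\setminus\{e_{n+1}\}\to\mathbb{R}^n$,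 $\rho(x,t)=\frac{x}{1-t}$, be the stereographic projection. Then $\widehat{X}=\rho^{-1}(X)\cup\{e_{n+1}\}$ if $X$ is unbounded, and $\widehat{X}=\rho^{-1}(X)$ if $X$ is bounded; similarly for $Y$ with $m$ in place of $n$.
   Formalization: An outer lipeomorphism of germs is also required to have its inverse send q to p; this is automatic when p is in the closure of A, and without it the claim fails, e.g. (2) but not (1) for X={0}∪{2^-k}, Y={2^k}, k≥1. *)

(* Defs.v *)
From HB Require Import structures.
From mathcomp Require Import all_boot all_order all_algebra.
From mathcomp Require Import all_classical all_reals all_analysis.
Set Implicit Arguments.
Unset Strict Implicit.
Unset Printing Implicit Defensive.
Import Order.TTheory GRing.Theory Num.Theory.
Import numFieldNormedType.Exports.
Local Open Scope classical_set_scope.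
Local Open Scope ring_scope.

(* R^n is 'rV[R]_n. The library norm on matrices is the sup norm, so the
   Euclidean norm is defined here. Open and compact sets and limits are those
   of the library (product) topology, which is the Euclidean one. *)
Definition enorm (R : realType) (n : nat) (x : 'rV[R]_n) : R :=
  Num.sqrt (\sum_(i < n) x 0 i ^+ 2).

Definition outer_dist (R : realType) (n : nat) (x y : 'rV[R]_n) : R :=
  enorm (x - y).

Definition ebounded (R : realType) (n : nat) (X : set 'rV[R]_n) : Prop :=
  exists M : R, forall x, X x -> enorm x <= M.

Definition outer_lipschitz (R : realType) (n m : nat)
    (A : set 'rV[R]_n) (f : 'rV[R]_n -> 'rV[R]_m) : Prop :=
  exists L : R, forall x y, A x -> A y ->
    outer_dist (f x) (f y) <= L * outer_dist x y.

(* Maps A -> B are represented by total functions whose values off A are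
   irrelevant; g is the inverse of h. *)
Definition outer_lipeo (R : realType) (n m : nat)
    (A : set 'rV[R]_n) (B : set 'rV[R]_m)
    (h : 'rV[R]_n -> 'rV[R]_m) (g : 'rV[R]_m -> 'rV[R]_n) : Prop :=
  [/\ set_fun A B h, set_fun B A g,
      {in A, cancel h g} & {in B, cancel g h}] /\
  outer_lipschitz A h /\ outer_lipschitz B g.

Definition outer_lipeo_at_infinity (R : realType) (n m : nat)
    (X : set 'rV[R]_n) (Y : set 'rV[R]_m) : Prop :=
  exists (K : set 'rV[R]_n) (K' : set 'rV[R]_m),
    [/\ compact K, compact K' &
        exists h g, outer_lipeo (X `\` K) (Y `\` K') h g].

Definition sends (R : realType) (n m : nat) (D : set 'rV[R]_n)
    (h : 'rV[R]_n -> 'rV[R]_m) (p : 'rV[R]_n) (q : 'rV[R]_m) : Prop :=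
  (D p -> h p = q) /\ h x @[x --> within D (nbhs p)] --> q.

(* The points p and q are exchanged by h and its inverse g. The clause for g
   follows from the one for h when p is adherent to A. When p is not adherent
   to A the clause for h is void, and the clause for g then says that q is not
   adherent to B: an empty germ is equivalent to empty germs only. Without it
   the relation would depend on A and B and not only on their germs. *)
Definition outer_lipeo_germs (R : realType) (n m : nat)
    (A : set 'rV[R]_n) (p : 'rV[R]_n) (B : set 'rV[R]_m) (q : 'rV[R]_m) :
    Prop :=
  exists (U : set 'rV[R]_n) (V : set 'rV[R]_m),
    [/\ open_nbhs p U, open_nbhs q V &
        exists h g, [/\ outer_lipeo (A `&` U) (B `&` V) h g,
                        sends (A `&` U) h p q & sends (B `&` V) g q p]].

Definition inversion (R : realType) (n : nat) (x : 'rV[R]_n) : 'rV[R]_n :=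
  (enorm x ^+ 2)^-1 *: x.

Definition inverted (R : realType) (n : nat) (X : set 'rV[R]_n) :
    set 'rV[R]_n :=
  @inversion R n @` (X `\` [set 0]).

(* A point (x, t) of R^(n+1) is row_mx x t, with x : 'rV_n and t : 'rV_1. *)
Definition pole (R : realType) (n : nat) : 'rV[R]_(n + 1) :=
  row_mx 0 (const_mx 1).

Definition unit_sphere (R : realType) (n : nat) : set 'rV[R]_n :=
  [set z | enorm z = 1].

Definition stereo_proj (R : realType) (n : nat) (z : 'rV[R]_(n + 1)) :
    'rV[R]_n :=
  (1 - rsubmx z 0 0)^-1 *: lsubmx z.

Definition stereo_preimage (R : realType) (n : nat) (X : set 'rV[R]_n) :
    set 'rV[R]_(n + 1) :=
  (@unit_sphere R (n + 1) `\` [set pole R n]) `&` @stereo_proj R n @^-1` X.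

Definition stereo_modification (R : realType) (n : nat) (X : set 'rV[R]_n) :
    set 'rV[R]_(n + 1) :=
  if `[< ebounded X >] then stereo_preimage X
  else stereo_preimage X `|` [set pole R n].

(* Main.v *)
(* An inversion of power k centred at p satisfies
   |psi x - psi y| = k |x - y| / (|x - p| |y - p|). Conjugating by it turns a
   bi-Lipschitz map h between neighbourhoods of infinity, for which |h x| and
   |x| are comparable, into a bi-Lipschitz map between punctured neighbourhoods
   of the centres, and conversely: there the comparability of |h z - q| and
   |z - p| follows from h(z) -> q and the Lipschitz conditions. Both the map
   x |-> x / |x|^2 and the stereographic projection, which is the inversion of
   power 2 centred at the pole, are of this kind, so (3) and (2) are each
   equivalent to (1). When p is not adherent to the germ, all the sets involved
   are bounded and the germs at infinity are empty. *)
Require Import Defs.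
From mathcomp Require Import all_boot all_order all_algebra.
From mathcomp Require Import all_classical all_reals all_analysis.
From mathcomp Require Import ring lra.
Import Order.TTheory GRing.Theory Num.Theory.
Import numFieldNormedType.Exports.
Set Implicit Arguments.
Unset Strict Implicit.
Unset Printing Implicit Defensive.
Local Open Scope classical_set_scope.
Local Open Scope ring_scope.

(** * The Euclidean norm *)

Section EuclideanNorm.
Variables (R : realType) (n : nat).
Implicit Types x y z : 'rV[R]_n.

Definition dot x y : R := \sum_(i < n) x 0 i * y 0 i.

Lemma dotC x y : dot x y = dot y x.
Proof. by apply: eq_bigr => i _; rewrite mulrC. Qed.

Lemma dotDl x y z : dot (x + y) z = dot x z + dot y z.
Proof. by rewrite -big_split; apply: eq_bigr => i _; rewrite mxE mulrDl. Qed.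

Lemma dotZl a x y : dot (a *: x) y = a * dot x y.
Proof. by rewrite mulr_sumr; apply: eq_bigr => i _; rewrite mxE mulrA. Qed.

Lemma dotNl x y : dot (- x) y = - dot x y.
Proof. by rewrite -scaleN1r dotZl mulN1r. Qed.

Lemma dotDr x y z : dot x (y + z) = dot x y + dot x z.
Proof. by rewrite dotC dotDl !(dotC x). Qed.

Lemma dotZr a x y : dot x (a *: y) = a * dot x y.
Proof. by rewrite dotC dotZl (dotC x). Qed.

Lemma dotNr x y : dot x (- y) = - dot x y.
Proof. by rewrite dotC dotNl (dotC x). Qed.

Definition dotE := (dotDl, dotDr, dotNl, dotNr, dotZl, dotZr).

Lemma dot_ge0 x : 0 <= dot x x.
Proof. by apply: sumr_ge0 => i _; rewrite -expr2 sqr_ge0. Qed.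

Lemma dot_eq0 x : dot x x = 0 -> x = 0.
Proof.
move/eqP; rewrite psumr_eq0; last by move=> i _; rewrite -expr2 sqr_ge0.
move/allP => x0; apply/rowP => i; apply/eqP.
by have := x0 i; rewrite mem_index_enum mulf_eq0 orbb mxE; apply.
Qed.

Lemma enormE x : enorm x = Num.sqrt (dot x x).
Proof. by congr Num.sqrt; apply: eq_bigr => i _; rewrite expr2. Qed.

Lemma enorm_ge0 x : 0 <= enorm x.
Proof. exact: sqrtr_ge0. Qed.

Lemma enorm_sqr x : enorm x ^+ 2 = dot x x.
Proof. by rewrite enormE sqr_sqrtr// dot_ge0. Qed.

Lemma enorm_eq0 x : enorm x = 0 -> x = 0.
Proof. by move=> x0; apply: dot_eq0; rewrite -enorm_sqr x0 expr0n. Qed.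

Lemma enorm0 : enorm (0 : 'rV[R]_n) = 0.
Proof. by rewrite enormE -(scale0r 0) dotZl mul0r sqrtr0. Qed.

Lemma enormZ a x : enorm (a *: x) = `|a| * enorm x.
Proof.
by rewrite !enormE dotZl dotZr mulrA -expr2 sqrtrM ?sqr_ge0// sqrtr_sqr.
Qed.

(** Cauchy-Schwarz: the squared norm of |y|^2 x - <x,y> y is |y|^2 (|x|^2 |y|^2 - <x,y>^2), and the
    factor |y|^2 cancels when it is positive. *)
Lemma dot_sqr_le x y : dot x y ^+ 2 <= dot x x * dot y y.
Proof.
have [y0|y0] := eqVneq (dot y y) 0.
  by rewrite (dot_eq0 y0) -(scale0r 0) !dotZr !mul0r mulr0 expr0n.
have y_gt0 : 0 < dot y y by rewrite lt_def y0 dot_ge0.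
have := dot_ge0 (dot y y *: x - dot x y *: y).
rewrite !dotE (dotC y x) => H.
rewrite -subr_ge0 -(pmulr_rge0 _ y_gt0).
by apply: le_trans H _; rewrite le_eqVlt; apply/orP; left; apply/eqP; ring.
Qed.

Lemma dot_le x y : dot x y <= enorm x * enorm y.
Proof.
apply: le_trans (ler_norm _) _.
rewrite -(@ler_pXn2r _ 2)// ?nnegrE ?mulr_ge0 ?enorm_ge0//.
by rewrite exprMn !enorm_sqr real_normK ?num_real// dot_sqr_le.
Qed.

Lemma enormD x y : enorm (x + y) <= enorm x + enorm y.
Proof.
rewrite -(@ler_pXn2r _ 2)// ?nnegrE ?addr_ge0 ?enorm_ge0//.
rewrite sqrrD !enorm_sqr !dotE (dotC y x).
by have := dot_le x y; lra.
Qed.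

Lemma outer_distxx x : outer_dist x x = 0.
Proof. by rewrite /outer_dist subrr enorm0. Qed.

Lemma outer_dist_ge0 x y : 0 <= outer_dist x y.
Proof. exact: enorm_ge0. Qed.

Lemma outer_distC x y : outer_dist x y = outer_dist y x.
Proof.
by rewrite /outer_dist -opprB -scaleN1r enormZ normrN normr1 mul1r.
Qed.

Lemma outer_dist_triangle y x z :
  outer_dist x z <= outer_dist x y + outer_dist y z.
Proof. by apply: le_trans (enormD _ _); rewrite addrA subrK. Qed.

Lemma outer_dist_eq0 x y : outer_dist x y = 0 -> x = y.
Proof. by move/enorm_eq0/eqP; rewrite subr_eq0 => /eqP. Qed.

Lemma enorm_le_dist x y : enorm x <= enorm y + outer_dist x y.
Proof. by have := enormD y (x - y); rewrite addrC subrK. Qed.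

Lemma outer_dist_le x y : outer_dist x y <= enorm x + enorm y.
Proof.
by have := enormD x (- y);
  rewrite -[- y]scaleN1r enormZ normrN normr1 mul1r scaleN1r.
Qed.

Lemma norm_le_enorm x : `|x| <= enorm x.
Proof.
have -> : `|x| = mx_norm x by [].
rewrite mx_normrE; apply: bigmax_le; first exact: enorm_ge0.
case=> i j _ /=; rewrite ord1.
rewrite -(@ler_pXn2r _ 2)// ?nnegrE ?enorm_ge0// real_normK ?num_real// enorm_sqr.
rewrite /dot (bigD1 j)//= -expr2 lerDl.
by apply: sumr_ge0 => k _; rewrite -expr2 sqr_ge0.
Qed.

(** The sharp factor is the square root of [n]; [n.+1] is positive even in dimension 0, so that
    radii can be divided by it. *)
Lemma enorm_le_norm x : enorm x <= n.+1%:R * `|x|.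
Proof.
rewrite -(@ler_pXn2r _ 2)// ?nnegrE ?mulr_ge0 ?enorm_ge0// enorm_sqr.
have coord_le i : x 0 i * x 0 i <= `|x| ^+ 2.
  rewrite -expr2 -real_normK ?num_real// ler_pXn2r ?nnegrE//.
  have -> : `|x| = mx_norm x by [].
  by rewrite mx_normrE; apply: (le_bigmax _ (fun ij => `|x ij.1 ij.2|) (0, i)).
apply: le_trans (ler_sum _ (fun i _ => coord_le i)) _.
rewrite sumr_const card_ord -[leLHS]mulr_natl exprMn.
apply: ler_wpM2r; first exact: sqr_ge0.
by rewrite -natrX ler_nat (leq_trans (leqnSn n))// leq_pmulr.
Qed.

End EuclideanNorm.

(** * The product topology described by the Euclidean distance *)

Section EuclideanTopology.
Variables (R : realType) (n : nat).
Implicit Types (x y : 'rV[R]_n) (U K : set 'rV[R]_n).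

Lemma nbhs_enormP x U :
  nbhs x U <-> exists2 e, 0 < e & forall y, outer_dist y x < e -> U y.
Proof.
have n0 : 0 < n.+1%:R :> R by rewrite ltr0n.
split=> [/nbhs_normP[e /= e0 eU]|[e e0 eU]].
  exists e => // y yx; apply: eU => /=.
  by rewrite distrC; apply: le_lt_trans (norm_le_enorm _) yx.
apply/(nbhs_normP x U); exists (e / n.+1%:R) => /=; first exact: divr_gt0.
move=> y /=; rewrite distrC ltr_pdivlMr// mulrC => yx; apply: eU.
by apply: le_lt_trans (enorm_le_norm _) yx.
Qed.

Lemma open_enormP U : open U <->
  forall x, U x -> exists2 e, 0 < e & forall y, outer_dist y x < e -> U y.
Proof.
rewrite openE; split=> oU x Ux; first by apply/nbhs_enormP; exact: oU.
by apply/nbhs_enormP; exact: oU.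
Qed.

Lemma compact_enormP K : compact K <-> open (~` K) /\ ebounded K.
Proof.
split=> [cK|[oK [M bK]]].
  split; first by apply: closed_openC; apply: compact_closed cK; exact: norm_hausdorff.
  have [M [_ /(_ (M + 1))]] := compact_bounded cK.
  rewrite ltrDl ltr01 => /(_ erefl) bK; exists (n.+1%:R * (M + 1)) => x Kx.
  by apply: le_trans (enorm_le_norm _) _; rewrite ler_pM2l ?ltr0n//; exact: bK.
apply: bounded_closed_compact; last by rewrite -[K]setCK; exact: open_closedC.
exists M; split=> [|N MN x Kx]; first exact: num_real.
by apply: le_trans (norm_le_enorm x) _; apply: le_trans (bK x Kx) (ltW MN).
Qed.

End EuclideanTopology.

Lemma sends_enormP (R : realType) (n m : nat) (D : set 'rV[R]_n)
    (h : 'rV[R]_n -> 'rV[R]_m) p q :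
  sends D h p q <-> (D p -> h p = q) /\
    forall e, 0 < e -> exists2 d, 0 < d &
      forall x, D x -> outer_dist x p < d -> outer_dist (h x) q < e.
Proof.
split=> -[hp hq]; split=> //.
  move=> e e0; have : nbhs q [set y | outer_dist y q < e].
    by apply/nbhs_enormP; exists e.
  move/hq => /nbhs_enormP[d d0 dD]; exists d => // x Dx xp; exact: dD.
move=> U /nbhs_enormP[e e0 eU]; have [d d0 dD] := hq e e0.
by apply/nbhs_enormP; exists d => // x xp Dx; apply: eU; exact: dD.
Qed.

(** * Lipeomorphisms between relatively open subsets *)

Section RelativeNeighbourhoods.
Variables (R : realType) (n : nat).
Implicit Types (p : 'rV[R]_n) (A S U X : set 'rV[R]_n).

(** Phrased inside [A], so that the condition can be checked through a chart, whose image need not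
    be open in the ambient space. *)
Definition rel_open A S := S `<=` A /\ forall z, S z ->
  exists2 e, 0 < e & forall y, A y -> outer_dist y z < e -> S y.

Definition nbhs_infinity X S :=
  rel_open X S /\ exists M, forall x, X x -> M < enorm x -> S x.

Definition rel_nbhs A p S := rel_open A S /\
  exists2 e, 0 < e & forall z, A z -> outer_dist z p < e -> S z.

(* The largest open set of the ambient space whose trace on A is contained
   in S. *)
Definition open_extension A S : set 'rV[R]_n := [set z |
  exists2 e, 0 < e & forall y, A y -> outer_dist y z < e -> S y].

Lemma open_extension_open A S : open (open_extension A S).
Proof.
apply/open_enormP => z [e e0 eS]; exists (e / 2); first by lra.
move=> y yz; exists (e / 2); first by lra.
move=> t At ty; apply: eS => //.
by have := outer_dist_triangle y t z; lra.
Qed.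

Lemma open_extension_trace A S : rel_open A S -> A `&` open_extension A S = S.
Proof.
case=> SA oS; apply/seteqP; split=> [z [Az [e e0]]|z Sz].
  by apply=> //; rewrite outer_distxx.
by split; [exact: SA | exact: oS].
Qed.

Lemma rel_open_trace A U : open U -> rel_open A (A `&` U).
Proof.
move/open_enormP => oU; split=> [z []//|z [_ /oU[e e0 eU]]].
by exists e => // y Ay /eU.
Qed.

Lemma nbhs_infinityP X S :
  nbhs_infinity X S <-> exists2 K, compact K & S = X `\` K.
Proof.
split=> [[oS [M MS]]|[K /compact_enormP[oK [M bK]] ->]].
  exists (~` open_extension X S).
    apply/compact_enormP; rewrite setCK; split; first exact: open_extension_open.
    (* The unit ball around a point of norm greater than [M + 1] stays outside radius [M], so such a
       point lies in the open extension. *)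
    exists (M + 1) => x; rewrite leNgt => nx; apply/negP => xM; apply: nx.
    exists 1 => // y Xy yx; apply: MS => //.
    by have := enorm_le_dist x y; rewrite outer_distC; lra.
  by rewrite setDE setCK open_extension_trace.
split; first by rewrite setDE; exact: rel_open_trace.
by exists M => x Xx Mx; split=> // /bK; lra.
Qed.

Lemma rel_nbhsP A p S :
  rel_nbhs A p S <-> exists2 U, open_nbhs p U & S = A `&` U.
Proof.
split=> [[oS pS]|[U [oU Up] ->]].
  exists (open_extension A S); last by rewrite open_extension_trace.
  by split; [exact: open_extension_open | exact: pS].
split; first exact: rel_open_trace.
have [e e0 eU] := (open_enormP U).1 oU p Up.
by exists e => // z Az /eU.
Qed.

End RelativeNeighbourhoods.

(* Half of the data of an outer lipeomorphism, the other half being obtained by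
   exchanging h and g. *)
Definition lipschitz_retract (R : realType) (n m : nat) (L : R)
    (S : set 'rV[R]_n) (T : set 'rV[R]_m)
    (h : 'rV[R]_n -> 'rV[R]_m) (g : 'rV[R]_m -> 'rV[R]_n) : Prop :=
  [/\ forall x, S x -> T (h x), forall x, S x -> g (h x) = x &
      forall x y, S x -> S y -> outer_dist (h x) (h y) <= L * outer_dist x y].

Lemma lipschitz_retract_le (R : realType) (n m : nat) (L L' : R)
    (S : set 'rV[R]_n) (T : set 'rV[R]_m) h g :
  L <= L' -> lipschitz_retract L S T h g -> lipschitz_retract L' S T h g.
Proof.
move=> LL' [hT gh hL]; split=> // x y Sx Sy.
by apply: le_trans (hL x y Sx Sy) _; apply: ler_wpM2r => //; exact: outer_dist_ge0.
Qed.

Lemma outer_lipeoP (R : realType) (n m : nat)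
    (S : set 'rV[R]_n) (T : set 'rV[R]_m) h g :
  outer_lipeo S T h g <-> exists L, [/\ 0 <= L,
    lipschitz_retract L S T h g & lipschitz_retract L T S g h].
Proof.
split=> [[[hT gS gh hg] [[L hL] [L' gL]]]|[L [_ [hT gh hL] [gS hg gL]]]].
  (* The two given constants may differ and may even be negative; this sum dominates both. *)
  exists (`|L| + `|L'|); split; first exact: addr_ge0.
    apply: (@lipschitz_retract_le _ _ _ L).
      by apply: le_trans (ler_norm L) _; rewrite lerDl.
    by split=> // x Sx; apply: gh; rewrite inE.
  apply: (@lipschitz_retract_le _ _ _ L').
    by apply: le_trans (ler_norm L') _; rewrite lerDr.
  by split=> // x Sx; apply: hg; rewrite inE.
by split; [split=> // x; rewrite inE; [exact: gh | exact: hg] | split; exists L].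
Qed.

Lemma lipeo_infinityP (R : realType) (n m : nat)
    (X : set 'rV[R]_n) (Y : set 'rV[R]_m) :
  outer_lipeo_at_infinity X Y <-> exists S T h g,
    [/\ nbhs_infinity X S, nbhs_infinity Y T & outer_lipeo S T h g].
Proof.
split=> [[K [K' [cK cK' [h [g hg]]]]]|[S [T [h [g []]]]]].
  by exists (X `\` K), (Y `\` K'), h, g; split=> //; apply/nbhs_infinityP;
    [exists K | exists K'].
move=> /nbhs_infinityP[K cK ->] /nbhs_infinityP[K' cK' ->] hg.
by exists K, K'; split=> //; exists h, g.
Qed.

Lemma lipeo_germsP (R : realType) (n m : nat)
    (A : set 'rV[R]_n) p (B : set 'rV[R]_m) q :
  outer_lipeo_germs A p B q <-> exists S T h g,
    [/\ rel_nbhs A p S, rel_nbhs B q T &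
        [/\ outer_lipeo S T h g, sends S h p q & sends T g q p]].
Proof.
split=> [[U [V [pU qV [h [g hg]]]]]|[S [T [h [g []]]]]].
  by exists (A `&` U), (B `&` V), h, g; split=> //; apply/rel_nbhsP;
    [exists U | exists V].
move=> /rel_nbhsP[U pU ->] /rel_nbhsP[V qV ->] hg.
by exists U, V; split=> //; exists h, g.
Qed.

(** * Shrinking a neighbourhood of infinity *)

(* The distance from x to a centre of inversion, which is |x| for the inversion
   and sqrt (|x|^2 + 1) for the stereographic projection. *)
Record weight (R : realType) (n : nat) (w : 'rV[R]_n -> R) : Prop := Weight {
  weight_lipschitz : forall x y, w x <= w y + outer_dist x y;
  enorm_le_weight : forall x, enorm x <= w x;
  weight_le_enorm : forall x, w x <= enorm x + 1 }.

Lemma lipschitz_retract_growth (R : realType) (n m : nat) (L : R)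
    (S : set 'rV[R]_n) (T : set 'rV[R]_m) h g :
  0 <= L -> lipschitz_retract L S T h g ->
  exists2 a, 0 <= a & forall x, S x -> enorm (h x) <= a + L * enorm x.
Proof.
move=> L0 [_ _ hL].
have [[x0 Sx0]|S0] := pselect (exists x, S x); last first.
  by exists 0 => // x Sx; case: S0; exists x.
exists (enorm (h x0) + L * enorm x0).
  by rewrite addr_ge0 ?mulr_ge0 ?enorm_ge0.
move=> x Sx; have := enorm_le_dist (h x) (h x0).
have := ler_wpM2l L0 (outer_dist_le x x0).
by have := hL x x0 Sx Sx0; lra.
Qed.

Section Shrink.
Variables (R : realType) (n m : nat).
Variables (w : 'rV[R]_n -> R) (w' : 'rV[R]_m -> R).

(** Weights above 1 keep [x] and [h x] where the charts are controlled and let additive constants in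
    growth bounds be absorbed. The condition is symmetric in [x] and [h x], so [g] still inverts [h]
    between the shrunken sets. *)
Definition shrink (S : set 'rV[R]_n) (h : 'rV[R]_n -> 'rV[R]_m) :=
  [set x | [/\ S x, 1 < w x & 1 < w' (h x)]].

End Shrink.

Section ShrinkTheory.
Variables (R : realType) (n m : nat) (L : R).
Variables (w : 'rV[R]_n -> R) (w' : 'rV[R]_m -> R).
Variables (X S : set 'rV[R]_n) (T : set 'rV[R]_m).
Variables (h : 'rV[R]_n -> 'rV[R]_m) (g : 'rV[R]_m -> 'rV[R]_n).
Hypotheses (ww : weight w) (ww' : weight w') (L0 : 0 <= L).
Hypotheses (hS : lipschitz_retract L S T h g) (gT : lipschitz_retract L T S g h).

Lemma shrink_retract :
  lipschitz_retract L (shrink w w' S h) (shrink w' w T g) h g.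
Proof.
have [hT gh hL] := hS.
split=> [x [Sx wx whx]|x [Sx _ _]|x y [Sx _ _] [Sy _ _]].
- by split; rewrite ?gh//; exact: hT.
- exact: gh.
- exact: hL.
Qed.

Lemma shrink_nbhs_infinity :
  nbhs_infinity X S -> nbhs_infinity X (shrink w w' S h).
Proof.
have [hT gh hL] := hS.
case=> -[SX oS] [M MS]; split.
  split=> [x [/SX]//|x [Sx wx whx]].
  have [e e0 eS] := oS x Sx.
  (* The last two terms keep [w] and the composite of [w'] with [h] above 1, these being Lipschitz
     with constants 1 and [L]; the divisor [L + 1] is positive even if [L = 0]. *)
  pose d := Num.min e (Num.min (w x - 1) ((w' (h x) - 1) / (L + 1))).
  have L1 : 0 < L + 1 by have := L0; lra.
  have d0 : 0 < d by rewrite !lt_min e0 subr_gt0 wx divr_gt0// subr_gt0.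
  exists d => // y Xy; rewrite !lt_min => /and3P[ye yw yh].
  have Sy := eS y Xy ye; split=> //.
    by have := weight_lipschitz ww x y; rewrite outer_distC; lra.
  move: yh; rewrite ltr_pdivlMr// => yh.
  have := weight_lipschitz ww' (h x) (h y); have := hL x y Sx Sy.
  rewrite (outer_distC x y); have := outer_dist_ge0 y x; lra.
have [a a0 ha] := lipschitz_retract_growth L0 gT.
(* If [w' (h x)] were at most 1, so would be the norm of [h x], and the growth of [g] would bound
   the norm of [x = g (h x)] by [a + L]. *)
exists (Num.max M (Num.max 1 (a + L))) => x Xx.
rewrite !gt_max => /and3P[Mx x1 ax]; have Sx := MS x Xx Mx; split=> //.
  exact: lt_le_trans x1 (enorm_le_weight ww x).
rewrite ltNge; apply/negP => whx.
have := ha (h x) (hT x Sx); rewrite gh// => xa.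
have : L * enorm (h x) <= L * 1.
  by apply: ler_wpM2l => //; apply: le_trans (enorm_le_weight ww' _) whx.
lra.
Qed.

(** The affine bound on [h] becomes linear because [1 < w x] on the shrunken set. *)
Lemma shrink_growth : exists2 C, 0 <= C &
  forall x, shrink w w' S h x -> w' (h x) <= C * w x.
Proof.
have [a a0 ha] := lipschitz_retract_growth L0 hS.
exists (a + 1 + L) => [|x [Sx wx _]]; first by rewrite !addr_ge0.
have := weight_le_enorm ww' (h x); have := ha x Sx.
have := ler_wpM2l L0 (enorm_le_weight ww x).
have := ler_wpM2l a0 (ltW wx); lra.
Qed.

(** A Lipschitz [g] carries the bounded [T] onto a bounded [S], and the rest of [X] is bounded. Used
    in both directions to show that the two centres belong to their germs simultaneously. *)
Lemma lipeo_unbounded : nbhs_infinity X S -> ebounded T -> ebounded X.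
Proof.
have [hT gh _] := hS.
case=> -[SX oS] [M MS] [N TN].
have [a a0 ha] := lipschitz_retract_growth L0 gT.
exists (Num.max M (a + L * N)) => x Xx; rewrite le_max.
have [//|/(MS x Xx) Sx] := leP (enorm x) M.
have := ha (h x) (hT x Sx); rewrite gh// => xa; apply: le_trans xa _.
by rewrite lerD2l ler_wpM2l//; exact/TN/hT.
Qed.

End ShrinkTheory.

(** * Inversion charts *)

(* psi behaves like an inversion of power k centred at p, with w x in the role
   of the distance from x to the centre. The flag b tells whether the centre is
   added to A when X is unbounded (stereographic modification) or never
   (inversion). *)
Record inversion_chart (R : realType) (n a : nat) (k : R) (b : bool)
    (X : set 'rV[R]_n) (A : set 'rV[R]_a) (p : 'rV[R]_a)
    (phi : 'rV[R]_a -> 'rV[R]_n) (psi : 'rV[R]_n -> 'rV[R]_a)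
    (w : 'rV[R]_n -> R) : Prop := InversionChart {
  chart_weight : weight w;
  chart_power : 0 < k;
  chart_cancel : forall x, 0 < w x -> phi (psi x) = x;
  chart_dist : forall x y, 0 < w x -> 0 < w y ->
    outer_dist (psi x) (psi y) * (w x * w y) = k * outer_dist x y;
  chart_pole : forall x, 0 < w x -> outer_dist (psi x) p * w x = k;
  chart_in : forall x, X x -> 0 < w x -> A (psi x);
  chart_out : forall z, A z -> z <> p ->
    exists x, [/\ X x, 0 < w x & z = psi x];
  chart_centre : A p <-> b /\ ~ ebounded X }.

Section ChartNeighbourhoods.
Variables (R : realType) (n a : nat) (k : R) (b : bool).
Variables (X : set 'rV[R]_n) (A : set 'rV[R]_a) (p : 'rV[R]_a).
Variables (phi : 'rV[R]_a -> 'rV[R]_n) (psi : 'rV[R]_n -> 'rV[R]_a).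
Variable w : 'rV[R]_n -> R.
Hypothesis ch : inversion_chart k b X A p phi psi w.

Definition germ_of (S : set 'rV[R]_n) : set 'rV[R]_a :=
  [set z | A z /\ (z = p \/ exists x, [/\ S x, 0 < w x & z = psi x])].

Definition end_of (S : set 'rV[R]_a) : set 'rV[R]_n :=
  [set x | [/\ X x, 0 < w x & S (psi x)]].

Lemma chart_neq x : 0 < w x -> psi x <> p.
Proof.
move=> wx psix; have := chart_pole ch wx; have := chart_power ch.
by rewrite psix outer_distxx mul0r => /[swap] <-; rewrite ltxx.
Qed.

(** By [chart_pole] the distance from [psi x] to [p] is [k / w x]: being close to the centre means
    having a large weight. *)
Lemma chart_near x d : 0 < w x -> 0 < d -> outer_dist (psi x) p < k / d -> d < w x.
Proof.
move=> wx d0; rewrite ltr_pdivlMr// -(chart_pole ch wx) ltr_pM2l//.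
rewrite lt_def enorm_ge0 andbT; apply/eqP => /outer_dist_eq0.
exact: chart_neq.
Qed.

Lemma chart_far x d : 0 < d -> k / d < w x -> outer_dist (psi x) p < d.
Proof.
move=> d0 kw.
have wx : 0 < w x by apply: lt_trans kw; rewrite divr_gt0// (chart_power ch).
by move: kw; rewrite ltr_pdivrMr// -(chart_pole ch wx) mulrC ltr_pM2l.
Qed.

Lemma germ_of_nbhs S : nbhs_infinity X S -> rel_nbhs A p (germ_of S).
Proof.
have k0 := chart_power ch; have ww := chart_weight ch.
case=> -[SX oS] [M MS].
have near_p : exists2 e, 0 < e &
    forall z, A z -> outer_dist z p < e -> germ_of S z.
  have M1 : 0 < `|M| + 1 by rewrite ltr_wpDl.
  (* Closer to [p] than this, [psi x] has [w x] above [|M| + 1], hence the norm of [x] exceeds [M],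
     a weight being at most the norm plus 1. *)
  exists (k / (`|M| + 1)); first exact: divr_gt0.
  move=> z Az zp; split=> //; have [->|/(chart_out ch Az)] := pselect (z = p).
    by left.
  case=> x [Xx wx zx]; right; exists x; split=> //; apply: MS => //.
  have := chart_near wx M1; rewrite -zx => /(_ zp).
  by have := weight_le_enorm ww x; have := ler_norm M; lra.
split=> //; split=> [z []//|z [Az [->//|[x [Sx wx zx]]]]].
have [e e0 eS] := oS x Sx.
(* With s the distance from [y] to [x], the images are at distance k s / (w x w y), at least k s /
   (w x (w x + s)). This increases with s, so s at least [e] would give at least the chosen
   radius. *)
exists (k * e / (w x * (w x + e))).
  by rewrite divr_gt0 ?mulr_gt0// addr_gt0.
move=> t At tz; split=> //; have [->|/(chart_out ch At)] := pselect (t = p).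
  by left.
case=> y [Xy wy ty]; right; exists y; split=> //; apply: eS => //.
rewrite ltNge; apply/negP => ye.
move: tz; rewrite ltr_pdivlMr ?mulr_gt0 ?addr_gt0// ltNge => /negP; apply.
have := chart_dist ch wy wx; rewrite -ty -zx => tz.
have wyx := weight_lipschitz ww y x.
rewrite -(ler_pM2r wy).
have -> : outer_dist t z * (w x * (w x + e)) * w y =
  k * (outer_dist y x * (w x + e)) by rewrite [RHS]mulrA -tz; ring.
rewrite -mulrA ler_pM2l//.
have h1 : 0 <= (outer_dist y x - e) * w x by rewrite mulr_ge0 ?subr_ge0// ltW.
have h2 := ler_wpM2l (ltW e0) wyx.
lra.
Qed.

Lemma end_of_nbhs S : rel_nbhs A p S -> nbhs_infinity X (end_of S).
Proof.
have k0 := chart_power ch; have ww := chart_weight ch.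
case=> -[SA oS] [e e0 eS]; split; last first.
  exists (k / e) => x Xx kx.
  have kw : k / e < w x := lt_le_trans kx (enorm_le_weight ww x).
  have wx : 0 < w x by exact: lt_trans (divr_gt0 k0 e0) kw.
  by split=> //; apply: eS; [exact: (chart_in ch) | exact: chart_far e0 kw].
split=> [x []//|x [Xx wx Sx]].
have [d d0 dS] := oS _ Sx.
(* The first term forces [w y > w x / 2]. The distance between the images is then at most 2 k / (w
   x)^2 times that between the points, and the second term makes it smaller than [d]. *)
exists (Num.min (w x / 2) (d * (w x * w x) / (2 * k))).
  by rewrite lt_min !(divr_gt0, mulr_gt0).
move=> y Xy; rewrite lt_min => /andP[yw].
rewrite ltr_pdivlMr ?mulr_gt0// => yd.
have yx : w x / 2 < w y.
  by have := weight_lipschitz ww x y; rewrite outer_distC; lra.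
have wy : 0 < w y by lra.
split=> //; apply: dS; first exact: (chart_in ch).
rewrite -(@ltr_pM2r _ (w x * w x)) ?mulr_gt0//.
apply: le_lt_trans yd.
have -> : outer_dist y x * (2 * k) = 2 * (k * outer_dist y x) by ring.
rewrite -(chart_dist ch wy wx).
have -> : 2 * (outer_dist (psi y) (psi x) * (w y * w x)) =
  outer_dist (psi y) (psi x) * (2 * w y * w x) by ring.
apply: ler_wpM2l; first exact: enorm_ge0.
by rewrite ler_pM2r//; lra.
Qed.

(** A point of [X] of norm above [k / e] would be carried closer to [p] than [e]. *)
Lemma end_bounded e : 0 < e -> (forall z, A z -> e <= outer_dist z p) ->
  ebounded X.
Proof.
move=> e0 eA; exists (k / e) => x Xx; rewrite leNgt; apply/negP => kx.
have kw := lt_le_trans kx (enorm_le_weight (chart_weight ch) x).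
have wx : 0 < w x by apply: lt_trans kw; rewrite divr_gt0// (chart_power ch).
by have := chart_far e0 kw; rewrite ltNge eA//; exact: (chart_in ch).
Qed.

Lemma isolated_bounded e S : rel_nbhs A p S -> 0 < e ->
  (forall z, S z -> e <= outer_dist z p) -> ebounded X.
Proof.
case=> _ [d d0 dS] e0 eS; apply: (@end_bounded (Num.min d e)).
  by rewrite lt_min d0.
move=> z Az; rewrite ge_min; have [//|/dS Sz] := leP d (outer_dist z p).
exact/eS/Sz.
Qed.

End ChartNeighbourhoods.

Lemma nbhs_infinity0 (R : realType) n (X : set 'rV[R]_n) :
  ebounded X -> nbhs_infinity X set0.
Proof.
move=> [M XM]; split; first by split=> [x []|x []].
by exists M => x /XM; rewrite leNgt => /negP.
Qed.

(** Obtained by letting the second point of the Lipschitz estimate tend to [p], which the adherence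
    of [p] to [S] allows. It turns a limit condition into a linear comparison of distances to the
    centres. *)
Lemma sends_growth (R : realType) (a c : nat) (L : R) (S : set 'rV[R]_a)
    (h : 'rV[R]_a -> 'rV[R]_c) p q :
  0 <= L ->
  (forall x y, S x -> S y -> outer_dist (h x) (h y) <= L * outer_dist x y) ->
  (forall e, 0 < e -> exists2 z, S z & outer_dist z p < e) -> sends S h p q ->
  forall z, S z -> outer_dist (h z) q <= L * outer_dist z p.
Proof.
move=> L0 hL adh /sends_enormP[_ lim] z Sz; apply/ler_addgt0Pr => e e0.
have [d d0 dS] := lim (e / 2) ltac:(lra).
have L1 : 0 < 2 * (L + 1) by lra.
(* A point [t] this close to [p] contributes at most [e / 2] through the Lipschitz estimate, and
   less than [e / 2] through the limit at [p]. *)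
have d1 : 0 < Num.min d (e / (2 * (L + 1))) by rewrite lt_min d0 divr_gt0.
have [t St] := adh _ d1.
rewrite lt_min ltr_pdivlMr// => /andP[td te].
have := outer_dist_triangle (h t) (h z) q; have := dS t St td.
have := hL z t Sz St.
have := ler_wpM2l L0 (outer_dist_triangle p z t).
by rewrite (outer_distC p t); have := outer_dist_ge0 t p; lra.
Qed.

(** * Transport of maps through the charts *)

Section ChartTransfer.
Variables (R : realType) (n m a c : nat) (k : R) (b : bool).
Variables (X : set 'rV[R]_n) (A : set 'rV[R]_a) (p : 'rV[R]_a).
Variables (phi : 'rV[R]_a -> 'rV[R]_n) (psi : 'rV[R]_n -> 'rV[R]_a).
Variable w : 'rV[R]_n -> R.
Variables (Y : set 'rV[R]_m) (B : set 'rV[R]_c) (q : 'rV[R]_c).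
Variables (phi' : 'rV[R]_c -> 'rV[R]_m) (psi' : 'rV[R]_m -> 'rV[R]_c).
Variable w' : 'rV[R]_m -> R.

(** The value at [p] is imposed: [p] may belong to the germ, while a chart says nothing about
    [phi p]. *)
Definition germ_map (h : 'rV[R]_n -> 'rV[R]_m) (z : 'rV[R]_a) : 'rV[R]_c :=
  if z == p then q else psi' (h (phi z)).

Definition end_map (h : 'rV[R]_a -> 'rV[R]_c) (x : 'rV[R]_n) : 'rV[R]_m :=
  phi' (h (psi x)).

End ChartTransfer.

Section ChartTransferTheory.
Variables (R : realType) (n m a c : nat) (k : R) (b : bool).
Variables (X : set 'rV[R]_n) (A : set 'rV[R]_a) (p : 'rV[R]_a).
Variables (phi : 'rV[R]_a -> 'rV[R]_n) (psi : 'rV[R]_n -> 'rV[R]_a).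
Variable w : 'rV[R]_n -> R.
Variables (Y : set 'rV[R]_m) (B : set 'rV[R]_c) (q : 'rV[R]_c).
Variables (phi' : 'rV[R]_c -> 'rV[R]_m) (psi' : 'rV[R]_m -> 'rV[R]_c).
Variable w' : 'rV[R]_m -> R.
Hypothesis chX : inversion_chart k b X A p phi psi w.
Hypothesis chY : inversion_chart k b Y B q phi' psi' w'.

Section GermMap.
Variables (L C : R) (S : set 'rV[R]_n) (T : set 'rV[R]_m).
Variables (h : 'rV[R]_n -> 'rV[R]_m) (g : 'rV[R]_m -> 'rV[R]_n).
Hypotheses (L0 : 0 <= L) (C0 : 0 <= C).
Hypothesis hS : lipschitz_retract L S T h g.
Hypotheses (TY : T `<=` Y) (wT : forall y, T y -> 0 < w' y).
Hypothesis growth : forall x, S x -> w x <= C * w' (h x).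

Let H := germ_map p phi q psi' h.
Let G := germ_map q phi' p psi g.

Lemma germ_map_psi x : 0 < w x -> H (psi x) = psi' (h x).
Proof.
move=> wx; rewrite /H /germ_map (chart_cancel chX wx).
by case: eqP => // /(chart_neq chX wx).
Qed.

(** Distances to the centres are [k] divided by the weights, so the comparison [growth] of weights
    is reversed into this one. *)
Lemma germ_map_pole z : germ_of A p psi w S z ->
  outer_dist (H z) q <= C * outer_dist z p.
Proof.
have [hT _ _] := hS.
case=> _ [->|[x [Sx wx ->]]].
  by rewrite /H /germ_map eqxx !outer_distxx mulr0.
have why := wT (hT x Sx).
rewrite germ_map_psi// -(ler_pM2r (mulr_gt0 wx why)).
have -> : C * outer_dist (psi x) p * (w x * w' (h x)) =
  C * w' (h x) * (outer_dist (psi x) p * w x) by ring.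
rewrite [leLHS]mulrCA (chart_pole chY why) (chart_pole chX wx).
by rewrite ler_pM2r ?(chart_power chX)// growth.
Qed.

(** For two points off the centre, [chart_dist] on both sides costs [L] for [h] and a factor [C] for
    each weight; the summand [C] covers the pairs containing [p], by [germ_map_pole]. *)
Lemma germ_map_retract : (A p -> B q) ->
  lipschitz_retract (L * (C * C) + C) (germ_of A p psi w S)
    (germ_of B q psi' w' T) H G.
Proof.
have [hT gh hL] := hS; have k0 := chart_power chX.
have K0 : 0 <= L * (C * C) by rewrite !mulr_ge0.
move=> AB; split.
- move=> z [Az [zp|[x [Sx wx ->]]]].
    rewrite zp in Az *; rewrite /H /germ_map eqxx; split; first exact: AB.
    by left.
  rewrite germ_map_psi//; have why := wT (hT x Sx).
  split; first by apply: (chart_in chY) => //; exact/TY/hT.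
  by right; exists (h x); split=> //; exact: hT.
- move=> z [Az [->|[x [Sx wx ->]]]]; first by rewrite /G /H /germ_map !eqxx.
  rewrite germ_map_psi//; have why := wT (hT x Sx).
  rewrite /G /germ_map (chart_cancel chY why) gh//.
  by case: eqP => // /(chart_neq chY why).
have Hp z : germ_of A p psi w S z ->
    outer_dist (H z) q <= (L * (C * C) + C) * outer_dist z p.
  move=> Sz; apply: le_trans (germ_map_pole Sz) _.
  by apply: ler_wpM2r; [exact: enorm_ge0 | rewrite lerDr].
have Hpp : H p = q by rewrite /H /germ_map eqxx.
move=> z t Sz St; have [_ [zp|[x [Sx wx zx]]]] := Sz.
  by rewrite zp Hpp outer_distC (outer_distC p); exact: Hp.
have [_ [tp|[y [Sy wy ty]]]] := St; first by rewrite tp Hpp; exact: Hp.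
rewrite zx ty !germ_map_psi//.
have whx := wT (hT x Sx); have why := wT (hT y Sy).
set D := outer_dist (psi' _) _; set E := outer_dist (psi x) _.
have E0 : 0 <= E := outer_dist_ge0 _ _.
apply: (@le_trans _ _ (L * (C * C) * E)); last first.
  by apply: ler_wpM2r => //; rewrite lerDl.
rewrite -(ler_pM2r (mulr_gt0 whx why)) (chart_dist chY whx why).
apply: (@le_trans _ _ (k * (L * outer_dist x y))).
  by rewrite ler_pM2l//; exact: hL.
rewrite mulrCA -(chart_dist chX wx wy) -/E.
have -> : L * (C * C) * E * (w' (h x) * w' (h y)) =
  L * (E * ((C * w' (h x)) * (C * w' (h y)))) by ring.
apply: ler_wpM2l => //; apply: ler_wpM2l => //.
by apply: ler_pM; rewrite ?(ltW wx) ?(ltW wy)// growth.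
Qed.

Lemma germ_map_sends : sends (germ_of A p psi w S) H p q.
Proof.
apply/sends_enormP; split=> [_|e e0]; first by rewrite /H /germ_map eqxx.
have C1 : 0 < C + 1 by rewrite ltr_wpDl.
exists (e / (C + 1)); first exact: divr_gt0.
move=> z Sz; rewrite ltr_pdivlMr// => ze.
by have := germ_map_pole Sz; have := outer_dist_ge0 z p; lra.
Qed.

End GermMap.

Section EndMap.
Variables (L : R) (S : set 'rV[R]_a) (T : set 'rV[R]_c).
Variables (h : 'rV[R]_a -> 'rV[R]_c) (g : 'rV[R]_c -> 'rV[R]_a).
Hypothesis hS : lipschitz_retract L S T h g.
Hypotheses (gqp : T q -> g q = p) (TB : T `<=` B).
Hypothesis growth : forall t, T t -> outer_dist (g t) p <= L * outer_dist t q.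

(** The image of [psi x] under [h] cannot be [q]: applying [g] would give [psi x = p]. It is
    therefore a value of [psi']. *)
Lemma end_map_spec x : end_of X psi w S x -> exists y,
  [/\ Y y, 0 < w' y, h (psi x) = psi' y & end_map psi phi' h x = y].
Proof.
have [hT gh _] := hS.
case=> Xx wx Sx; have Thx := hT _ Sx.
have hq : h (psi x) <> q.
  move=> hq; apply: (chart_neq chX wx).
  by rewrite -(gh _ Sx) hq gqp// -hq.
have [y [Yy wy hy]] := chart_out chY (TB Thx) hq.
by exists y; split=> //; rewrite /end_map hy (chart_cancel chY wy).
Qed.

Lemma end_map_weight x y : end_of X psi w S x -> 0 < w' y ->
  h (psi x) = psi' y -> w' y <= L * w x.
Proof.
have [hT gh _] := hS.
case=> Xx wx Sx wy hy; have := growth (hT _ Sx); rewrite gh// hy.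
rewrite -(ler_pM2r (mulr_gt0 wx wy)) mulrA (chart_pole chX wx).
have -> : L * outer_dist (psi' y) q * (w x * w' y) =
  L * w x * (outer_dist (psi' y) q * w' y) by ring.
by rewrite (chart_pole chY wy) mulrC ler_pM2r ?(chart_power chX).
Qed.

(** The constant collects one [L] from [h] and one from each of the two weight comparisons, through
    [chart_dist] on both sides. *)
Lemma end_map_retract :
  lipschitz_retract (L * (L * L)) (end_of X psi w S) (end_of Y psi' w' T)
    (end_map psi phi' h) (end_map psi' phi g).
Proof.
have [hT gh hL] := hS; have k0 := chart_power chX.
split=> [x Sx|x Sx|x y Sx Sy].
- have [y [Yy wy hy ->]] := end_map_spec Sx.
  by case: Sx => _ _ Sx; split=> //; rewrite -hy; exact: hT.
- have [y [Yy wy hy ->]] := end_map_spec Sx.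
  case: Sx => _ wx Sx.
  by rewrite /end_map -hy gh// (chart_cancel chX wx).
have [x' [_ wx' hx xx']] := end_map_spec Sx.
have [y' [_ wy' hy yy']] := end_map_spec Sy.
rewrite xx' yy'.
have Cx := end_map_weight Sx wx' hx; have Cy := end_map_weight Sy wy' hy.
case: Sx Sy => _ wx Sx [_ wy Sy].
rewrite -(ler_pM2l k0) -(chart_dist chY wx' wy') -hx -hy.
apply: (@le_trans _ _ ((L * outer_dist (psi x) (psi y)) *
  ((L * w x) * (L * w y)))).
  apply: ler_pM; rewrite ?outer_dist_ge0 ?mulr_ge0 ?(ltW wx') ?(ltW wy')//.
    exact: hL.
  by apply: ler_pM => //; exact: ltW.
have -> : k * (L * (L * L) * outer_dist x y) =
  L * (L * L) * (k * outer_dist x y) by ring.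
rewrite -(chart_dist chX wx wy) le_eqVlt; apply/orP; left; apply/eqP; ring.
Qed.

End EndMap.

End ChartTransferTheory.

(** * Passage between ends and germs in a pair of charts *)

Lemma chart_end_to_germ (R : realType) (n m a c : nat) (k : R) (b : bool)
    (X : set 'rV[R]_n) (A : set 'rV[R]_a) p phi psi w
    (Y : set 'rV[R]_m) (B : set 'rV[R]_c) q phi' psi' w' :
  inversion_chart k b X A p phi psi w ->
  inversion_chart k b Y B q phi' psi' w' ->
  outer_lipeo_at_infinity X Y -> outer_lipeo_germs A p B q.
Proof.
move=> chX chY /lipeo_infinityP[S [T [h [g [SX TY /outer_lipeoP[L [L0 hS gT]]]]]]].
have ww := chart_weight chX; have ww' := chart_weight chY.
have sTY : T `<=` Y by case: TY => -[].
have sSX : S `<=` X by case: SX => -[].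
have AB : A p -> B q.
  move=> /(chart_centre chX)[b1 uX]; apply/(chart_centre chY); split=> // -[M YM].
  by apply: uX; apply: (lipeo_unbounded L0 hS gT SX); exists M => y /sTY /YM.
have BA : B q -> A p.
  move=> /(chart_centre chY)[b1 uY]; apply/(chart_centre chX); split=> // -[M XM].
  by apply: uY; apply: (lipeo_unbounded L0 gT hS TY); exists M => y /sSX /XM.
have [C C0 hC] := shrink_growth ww ww' L0 hS.
have [C' C'0 gC'] := shrink_growth ww' ww L0 gT.
have hS1 := shrink_retract w w' hS; have gT1 := shrink_retract w' w gT.
have SX1 := shrink_nbhs_infinity ww ww' L0 hS gT SX.
have TY1 := shrink_nbhs_infinity ww' ww L0 gT hS TY.
set S1 := shrink w w' S h in hS1 gT1 SX1 hC.
set T1 := shrink w' w T g in hS1 gT1 TY1 gC'.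
have [hT gh _] := hS1; have [gS hg _] := gT1.
have S1X : S1 `<=` X by move=> x [/sSX].
have T1Y : T1 `<=` Y by move=> y [/sTY].
have wS1 x : S1 x -> 0 < w x by case=> _ wx _; apply: lt_trans wx.
have wT1 y : T1 y -> 0 < w' y by case=> _ wy _; apply: lt_trans wy.
(* The constants cross over: the growth of [g] at [h x] is what bounds [w x] by [w' (h x)], as the
   transport of [h] requires. *)
have hC' x : S1 x -> w x <= C' * w' (h x).
  by move=> Sx; have := gC' (h x) (hT x Sx); rewrite gh.
have gC y : T1 y -> w' y <= C * w (g y).
  by move=> Ty; have := hC (g y) (gS y Ty); rewrite hg.
apply/lipeo_germsP.
exists (germ_of A p psi w S1), (germ_of B q psi' w' T1),
  (germ_map p phi q psi' h), (germ_map q phi' p psi g).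
split; [exact: (germ_of_nbhs chX) | exact: (germ_of_nbhs chY) |].
split; [|exact (germ_map_sends chX chY C'0 hS1 wT1 hC') |
  exact (germ_map_sends chY chX C0 gT1 wS1 gC)].
have hR := germ_map_retract chX chY L0 C'0 hS1 T1Y wT1 hC' AB.
have gR := germ_map_retract chY chX L0 C0 gT1 S1X wS1 gC BA.
apply/outer_lipeoP; exists (Num.max (L * (C' * C') + C') (L * (C * C) + C)).
split.
- by rewrite le_max addr_ge0// !mulr_ge0.
- by apply: lipschitz_retract_le hR; rewrite le_max lexx.
- by apply: lipschitz_retract_le gR; rewrite le_max lexx orbT.
Qed.

Lemma chart_germ_to_end (R : realType) (n m a c : nat) (k : R) (b : bool)
    (X : set 'rV[R]_n) (A : set 'rV[R]_a) p phi psi w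
    (Y : set 'rV[R]_m) (B : set 'rV[R]_c) q phi' psi' w' :
  inversion_chart k b X A p phi psi w ->
  inversion_chart k b Y B q phi' psi' w' ->
  outer_lipeo_germs A p B q -> outer_lipeo_at_infinity X Y.
Proof.
move=> chX chY /lipeo_germsP[S [T [h [g [SA TB]]]]].
case=> /outer_lipeoP[L [L0 hS gT]] hpq gqp; apply/lipeo_infinityP.
have [hT gh hL] := hS; have [gS hg gL] := gT.
have [_ hlim] := (sends_enormP _ _ _ _).1 hpq.
have [gq glim] := (sends_enormP _ _ _ _).1 gqp.
have [hq _] := hpq.
have sSA : S `<=` A by case: SA => -[].
have sTB : T `<=` B by case: TB => -[].
(* If [p] is not adherent to [S], the limit of [g] keeps [T] away from [q]; then [X] and [Y] are
   bounded, and the empty set is a neighbourhood of infinity in each. *)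
have [adh|nadh] := pselect (forall e, 0 < e ->
    exists2 z, S z & outer_dist z p < e); last first.
  have [e [e0 eS]] : exists e, 0 < e /\ forall z, S z -> e <= outer_dist z p.
    apply: contrapT => noe; apply: nadh => e e0; apply: contrapT => nz; apply: noe.
    exists e; split=> // z Sz; rewrite leNgt; apply/negP => ze.
    by apply: nz; exists z.
  have [d d0 dT] := glim e e0.
  have dT' y : T y -> d <= outer_dist y q.
    move=> Ty; rewrite leNgt; apply/negP => /(dT y Ty).
    by rewrite ltNge eS//; exact: gS.
  exists set0, set0, (fun=> 0), (fun=> 0); split.
  - exact: nbhs_infinity0 (isolated_bounded chX SA e0 eS).
  - exact: nbhs_infinity0 (isolated_bounded chY TB d0 dT').
  by apply/outer_lipeoP; exists 0; split.
(* Adherence passes from [p] to [q] along [h], so the linear comparison is available for both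
   maps. *)
have adh' e : 0 < e -> exists2 t, T t & outer_dist t q < e.
  move=> /hlim[d d0 dS]; have [z Sz zp] := adh d d0.
  by exists (h z); [exact: hT | exact: dS].
have hgr := sends_growth L0 hL adh hpq.
have ggr := sends_growth L0 gL adh' gqp.
exists (end_of X psi w S), (end_of Y psi' w' T),
  (end_map psi phi' h), (end_map psi' phi g).
split; [exact: (end_of_nbhs chX) | exact: (end_of_nbhs chY) |].
apply/outer_lipeoP; exists (L * (L * L)); split; first by rewrite !mulr_ge0.
- exact: (end_map_retract chX chY hS gq sTB ggr).
- exact: (end_map_retract chY chX gT hq sSA hgr).
Qed.

(** The common power [k] cancels in the estimates, and the common flag [b] makes the centres belong
    to both germs or to neither. *)
Lemma chart_lipeo (R : realType) (n m a c : nat) (k : R) (b : bool)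
    (X : set 'rV[R]_n) (A : set 'rV[R]_a) p phi psi w
    (Y : set 'rV[R]_m) (B : set 'rV[R]_c) q phi' psi' w' :
  inversion_chart k b X A p phi psi w ->
  inversion_chart k b Y B q phi' psi' w' ->
  outer_lipeo_at_infinity X Y <-> outer_lipeo_germs A p B q.
Proof.
by move=> chX chY; split; [exact: chart_end_to_germ chX chY |
  exact: chart_germ_to_end chX chY].
Qed.

(** * The inversion and the stereographic projection *)

Lemma enorm_gt0 (R : realType) n (x : 'rV[R]_n) : x <> 0 -> 0 < enorm x.
Proof.
by move=> x0; rewrite lt_def enorm_ge0 andbT; apply/eqP => /enorm_eq0.
Qed.

Lemma enorm_inversion (R : realType) n (x : 'rV[R]_n) :
  0 < enorm x -> enorm (inversion x) * enorm x = 1.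
Proof.
move=> x0; rewrite /inversion enormZ ger0_norm ?invr_ge0 ?sqr_ge0//.
by field; rewrite gt_eqF.
Qed.

Lemma inversionK (R : realType) n (x : 'rV[R]_n) : inversion (inversion x) = x.
Proof.
have [->|/eqP/enorm_gt0 x0] := eqVneq x 0; first by rewrite /inversion !scaler0.
have -> : inversion (inversion x) =
    ((enorm (inversion x) * enorm x) ^+ 2)^-1 *: x.
  by rewrite exprMn invfM -scalerA.
by rewrite enorm_inversion// expr1n invr1 scale1r.
Qed.

(** Both sides are nonnegative, so it suffices to compare squares, which expand into inner
    products. *)
Lemma dist_inversion (R : realType) n (x y : 'rV[R]_n) :
  0 < enorm x -> 0 < enorm y ->
  outer_dist (inversion x) (inversion y) * (enorm x * enorm y) =
  outer_dist x y.
Proof.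
move=> x0 y0; apply/eqP.
rewrite -(@eqrXn2 _ 2)// ?mulr_ge0 ?outer_dist_ge0 ?enorm_ge0//; apply/eqP.
rewrite !exprMn /outer_dist !enorm_sqr /inversion !dotE !enorm_sqr (dotC y x).
have xx : dot x x != 0 by rewrite -enorm_sqr expf_neq0// gt_eqF.
have yy : dot y y != 0 by rewrite -enorm_sqr expf_neq0// gt_eqF.
by field; rewrite yy.
Qed.

Lemma inversion_inverted_chart (R : realType) n (X : set 'rV[R]_n) :
  inversion_chart 1 false X (inverted X) 0 (@inversion R n) (@inversion R n)
    (@enorm R n).
Proof.
split=> //.
- by split=> [x y|//|x]; [exact: enorm_le_dist | rewrite lerDl].
- by move=> x _; exact: inversionK.
- by move=> x y x0 y0; rewrite dist_inversion// mul1r.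
- by move=> x x0; rewrite /outer_dist subr0 enorm_inversion.
- move=> x Xx x0; exists x => //; split=> // x00.
  by move: x0; rewrite x00 enorm0 ltxx.
- by move=> z [x [Xx x0] <-] _; exists x; split=> //; exact: enorm_gt0.
(* The centre never belongs to [inverted X]: the inversion is an involution fixing 0, so only 0 is
   sent to 0. *)
- split=> [[x [_ x0] ix]|[]//].
  by case: x0; rewrite -(inversionK x) ix /inversion scaler0.
Qed.

Section Stereographic.
Variables (R : realType) (n : nat).
Implicit Types (x y : 'rV[R]_n) (z : 'rV[R]_(n + 1)).

(* The stereographic projection is the inversion of power 2 centred at the
   pole, so its inverse is the inversion of x - pole, rescaled and translated
   back. *)
Definition from_pole x : 'rV[R]_(n + 1) := row_mx x (const_mx (-1)).

Definition stereo_inv x : 'rV[R]_(n + 1) :=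
  pole R n + 2 *: inversion (from_pole x).

Definition height z : R := rsubmx z 0 0.

Lemma dot_row_mx x y (s t : 'rV[R]_1) :
  dot (row_mx x s) (row_mx y t) = dot x y + s 0 0 * t 0 0.
Proof.
rewrite /dot big_split_ord /= big_ord1; congr (_ + _); last by rewrite !row_mxEr.
by apply: eq_bigr => i _; rewrite !row_mxEl.
Qed.

Lemma dot_sub z : dot z z = dot (lsubmx z) (lsubmx z) + height z ^+ 2.
Proof. by rewrite -{1 2}(hsubmxK z) dot_row_mx expr2. Qed.

Lemma dot_pole z : dot (pole R n) z = height z.
Proof.
rewrite -{1}(hsubmxK z) dot_row_mx mxE mul1r -(scale0r 0) dotZl mul0r add0r.
by [].
Qed.

Lemma dist_from_pole x y : outer_dist (from_pole x) (from_pole y) = outer_dist x y.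
Proof.
rewrite /outer_dist /from_pole opp_row_mx add_row_mx !enormE dot_row_mx.
by rewrite !mxE subrr mul0r addr0.
Qed.

Lemma enorm_from_pole_sqr x : enorm (from_pole x) ^+ 2 = dot x x + 1.
Proof. by rewrite enorm_sqr dot_row_mx !mxE mulrNN mulr1. Qed.

Lemma enorm_from_pole_gt0 x : 0 < enorm (from_pole x).
Proof.
apply: enorm_gt0 => x0; have := enorm_from_pole_sqr x.
by rewrite x0 enorm0 expr0n /=; have := dot_ge0 x; lra.
Qed.

Lemma height_stereo_inv x : 1 - height (stereo_inv x) = 2 / (dot x x + 1).
Proof.
rewrite -dot_pole dotDr dotZr /inversion dotZr enorm_from_pole_sqr !dot_pole.
by rewrite /height /pole /from_pole !row_mxKr !mxE; ring.
Qed.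

Lemma lsubmx_stereo_inv x : lsubmx (stereo_inv x) = (2 / (dot x x + 1)) *: x.
Proof.
rewrite /stereo_inv /inversion enorm_from_pole_sqr linearD !linearZ /=.
by rewrite !row_mxKl add0r scalerA.
Qed.

Lemma stereo_invK x : stereo_proj (stereo_inv x) = x.
Proof.
rewrite /stereo_proj -/(height _) height_stereo_inv lsubmx_stereo_inv scalerA.
have x1 : 0 < dot x x + 1 by rewrite ltr_wpDl// dot_ge0.
by rewrite mulVf ?scale1r// mulf_neq0// invr_neq0// gt_eqF.
Qed.

Lemma stereo_inv_sphere x : enorm (stereo_inv x) = 1.
Proof.
rewrite enormE /stereo_inv /inversion !dotE (dotC _ (pole R n)).
rewrite !dot_pole -enorm_sqr enorm_from_pole_sqr.
rewrite /height /pole /from_pole !row_mxKr !mxE.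
have x1 : dot x x + 1 != 0 by rewrite gt_eqF// ltr_wpDl// dot_ge0.
rewrite -[RHS]sqrtr1; congr Num.sqrt; by field.
Qed.

Lemma dist_stereo_inv x y :
  outer_dist (stereo_inv x) (stereo_inv y) *
    (enorm (from_pole x) * enorm (from_pole y)) = 2 * outer_dist x y.
Proof.
rewrite -(dist_from_pole x) -[in RHS]dist_inversion ?enorm_from_pole_gt0// [RHS]mulrA.
congr (_ * _); rewrite /outer_dist /stereo_inv opprD addrACA subrr add0r.
by rewrite -scalerBr enormZ ger0_norm.
Qed.

Lemma dist_stereo_inv_pole x :
  outer_dist (stereo_inv x) (pole R n) * enorm (from_pole x) = 2.
Proof.
rewrite /outer_dist /stereo_inv addrC addKr enormZ ger0_norm// -mulrA.
by rewrite enorm_inversion ?mulr1// enorm_from_pole_gt0.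
Qed.

Lemma stereo_inv_neq x : stereo_inv x <> pole R n.
Proof.
move=> xp; have := dist_stereo_inv_pole x.
by rewrite xp outer_distxx mul0r => /esym/eqP; rewrite pnatr_eq0.
Qed.

Lemma stereo_projK z : enorm z = 1 -> z <> pole R n ->
  stereo_inv (stereo_proj z) = z.
Proof.
move=> z1 zp; have := dot_sub z; rewrite -enorm_sqr z1 expr1n => lz.
(* On the sphere, height 1 forces the other coordinates to vanish, which leaves only the pole. *)
have t1 : 1 - height z != 0.
  rewrite subr_eq0; apply/eqP => t1; apply: zp.
  have /dot_eq0 l0 : dot (lsubmx z) (lsubmx z) = 0.
    by move: lz; rewrite -t1 expr1n; lra.
  rewrite -(hsubmxK z) l0.
  by congr row_mx; apply/rowP => i; rewrite ord1 [RHS]mxE t1.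
have ll : dot (lsubmx z) (lsubmx z) = 1 - height z ^+ 2 by rewrite lz; ring.
set x := stereo_proj z.
(* With t the height, |x|^2 = (1 - t^2) / (1 - t)^2, so |x|^2 + 1 = 2 / (1 - t). This factor
   determines both blocks of [stereo_inv x]. *)
have xx : 2 / (dot x x + 1) = 1 - height z.
  rewrite /x /stereo_proj -/(height z) !dotE ll.
  have t2 : 1 - height z ^+ 2 + (1 - height z) ^+ 2 != 0.
    have -> : 1 - height z ^+ 2 + (1 - height z) ^+ 2 = 2 * (1 - height z).
      by ring.
    by rewrite mulf_neq0.
  by field; rewrite t1 t2.
rewrite -[LHS]hsubmxK -[RHS]hsubmxK; congr row_mx.
  rewrite lsubmx_stereo_inv xx /x /stereo_proj -/(height z) scalerA divff//.
  by rewrite scale1r.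
apply/rowP => i; rewrite ord1 -/(height _) -/(height z).
by have := height_stereo_inv x; rewrite xx; lra.
Qed.

Lemma stereo_chart (X : set 'rV[R]_n) :
  inversion_chart 2 true X (stereo_modification X) (pole R n)
    (@stereo_proj R n) stereo_inv (fun x => enorm (from_pole x)).
Proof.
have pole_notin : ~ stereo_preimage X (pole R n) by case=> -[_ []].
have preimageE z : stereo_modification X z -> z <> pole R n ->
    stereo_preimage X z.
  by rewrite /stereo_modification; case: ifP => [//|_ []].
split=> //.
- split=> x.
  + by move=> y; rewrite -(dist_from_pole x y); exact: enorm_le_dist.
  + rewrite -(@ler_pXn2r _ 2)// ?nnegrE ?enorm_ge0//.
    by rewrite enorm_from_pole_sqr enorm_sqr lerDl.
  + rewrite -(@ler_pXn2r _ 2)// ?nnegrE ?addr_ge0 ?enorm_ge0//.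
    rewrite enorm_from_pole_sqr sqrrD expr1n mulr1 enorm_sqr.
    by have := enorm_ge0 x; lra.
- by move=> x _; exact: stereo_invK.
- by move=> x y _ _; exact: dist_stereo_inv.
- by move=> x _; exact: dist_stereo_inv_pole.
- move=> x Xx _.
  have xX : stereo_preimage X (stereo_inv x).
    split; last by rewrite /preimage /= stereo_invK.
    by split; [exact: stereo_inv_sphere | exact: stereo_inv_neq].
  by rewrite /stereo_modification; case: ifP => // _; left.
- move=> z zX zp; have [[z1 _] Xz] := preimageE z zX zp.
  exists (stereo_proj z); split=> //; first exact: enorm_from_pole_gt0.
  by rewrite stereo_projK.
(* Since [stereo_preimage] omits the pole, only the point added to an unbounded [X] can supply
   it. *)
- rewrite /stereo_modification; case: asboolP => bX.
    by split=> [/pole_notin|[]].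
  by split=> // _; right.
Qed.

End Stereographic.

Theorem theorem5p1 (R : realType) (n m : nat)
    (X : set 'rV[R]_n) (Y : set 'rV[R]_m) :
  (outer_lipeo_at_infinity X Y <->
   outer_lipeo_germs (stereo_modification X) (pole R n)
                     (stereo_modification Y) (pole R m)) /\
  (outer_lipeo_germs (stereo_modification X) (pole R n)
                     (stereo_modification Y) (pole R m) <->
   outer_lipeo_germs (inverted X) 0 (inverted Y) 0).
Proof.
have stereo := chart_lipeo (stereo_chart X) (stereo_chart Y).
have inv := chart_lipeo (inversion_inverted_chart X) (inversion_inverted_chart Y).
by split=> //; rewrite -stereo.
Qed.
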